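(* Let $f,g:[0;1]\to[0;1]^2$ be computable paths such that $f(0)=(0,0)$, $f(1)=(1,1)$, $g(0)=(0,1)$, $g(1)=(1,0)$, and such that for every $0<t<1$ both $f(t)$ and $g(t)$ belong to the open unit square $(0;1)^2$. Then there is a computable point $x\in\mathrm{range}(f)\cap\mathrm{range}(g)$.
   Context: Computability of functions $[0;1]\to\mathbb{R}^2$ is in the Grzegorczyk–Lacombe sense; a point of $\mathbb{R}^2$ is computable if both coordinates are computable reals. *)

(* Defs.v *)
From mathcomp Require Import all_boot all_order all_algebra.
From mathcomp Require Import classical_sets reals set_interval.

Set Implicit Arguments.
Unset Strict Implicit.
Unset Printing Implicit Defensive.

Import Order.TTheory GRing.Theory Num.Theory.
Local Open Scope ring_scope.

(* The total recursive functions of any arity.  Minimization is applied to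
   regular functions only, those for which a zero exists at every argument, so
   that no partial function is needed; the class obtained is that of the total
   computable functions (Kleene). *)
Inductive recursive : forall k : nat, (k.-tuple nat -> nat) -> Prop :=
| rec_zero k : recursive (fun _ : k.-tuple nat => 0%N)
| rec_succ : recursive (fun v : 1.-tuple nat => (thead v).+1)
| rec_proj k (i : 'I_k) : recursive (fun v : k.-tuple nat => tnth v i)
| rec_comp k m (f : m.-tuple nat -> nat) (g : 'I_m -> k.-tuple nat -> nat) :
    recursive f -> (forall i, recursive (g i)) ->
    recursive (fun v : k.-tuple nat => f [tuple g i v | i < m])
| rec_prim k (f : k.-tuple nat -> nat) (h : k.+2.-tuple nat -> nat)
    (g : k.+1.-tuple nat -> nat) :
    recursive f -> recursive h ->
    (forall v : k.-tuple nat, g [tuple of 0%N :: v] = f v) ->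
    (forall n (v : k.-tuple nat),
       g [tuple of n.+1 :: v] = h [tuple of n :: g [tuple of n :: v] :: v]) ->
    recursive g
| rec_min k (f : k.+1.-tuple nat -> nat) (g : k.-tuple nat -> nat) :
    recursive f ->
    (forall v, f [tuple of g v :: v] = 0%N /\
       forall m, (m < g v)%N -> f [tuple of m :: v] <> 0%N) ->
    recursive g.

Definition computable_rat (k : nat) (r : k.-tuple nat -> rat) : Prop :=
  exists s a b : k.-tuple nat -> nat,
    [/\ recursive s, recursive a, recursive b &
        forall v, b v <> 0%N /\ r v = (-1) ^+ s v * ((a v)%:R / (b v)%:R)].

Definition computable_real (R : realType) (x : R) : Prop :=
  exists r : 1.-tuple nat -> rat, computable_rat r /\
    forall n : nat, `|ratr (r [tuple n]) - x| <= 2 ^- n.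

Definition computable_seq (R : realType) (x : nat -> R) : Prop :=
  exists r : 2.-tuple nat -> rat, computable_rat r /\
    forall m n : nat, `|ratr (r [tuple m; n]) - x m| <= 2 ^- n.

Definition computable_point (R : realType) (p : R * R) : Prop :=
  computable_real p.1 /\ computable_real p.2.

Definition sequentially_computable (R : realType) (h : R -> R) : Prop :=
  forall x : nat -> R, (forall n, 0 <= x n <= 1) ->
    computable_seq x -> computable_seq (fun n => h (x n)).

Definition effectively_uniformly_continuous (R : realType) (h : R -> R) : Prop :=
  exists d : 1.-tuple nat -> nat, recursive d /\
    forall (n : nat) (s t : R), 0 <= s <= 1 -> 0 <= t <= 1 ->
      `|s - t| <= 2 ^- d [tuple n] -> `|h s - h t| <= 2 ^- n.

(* Grzegorczyk-Lacombe computability, in the form given by Pour-El and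
   Richards, of the restriction of h to [0, 1]; the values of h outside [0, 1]
   are irrelevant. *)
Definition GL_computable (R : realType) (h : R -> R) : Prop :=
  sequentially_computable h /\ effectively_uniformly_continuous h.

Definition computable_path (R : realType) (f : R -> R * R) : Prop :=
  GL_computable (fun t => (f t).1) /\ GL_computable (fun t => (f t).2).

Definition closed_unit_square (R : realType) (p : R * R) : Prop :=
  0 <= p.1 <= 1 /\ 0 <= p.2 <= 1.

Definition open_unit_square (R : realType) (p : R * R) : Prop :=
  0 < p.1 < 1 /\ 0 < p.2 < 1.

Definition path_range (R : realType) (f : R -> R * R) : set (R * R) :=
  (f @` `[0%R, 1%R])%classic.

(* Main.v *)
(* A point f(c) with c rational is computable, so we may assume that no such
   point lies on g.  For p off g, let side(p) be the parity of the number of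
   crossings of a sufficiently fine polygon inscribed in g with the vertical
   ray going up from p.  It is locally constant off g, it is odd at
   (0,0) and even at (1,1), and it can be decided at f(c) for rational c: a
   search over precisions stops as soon as the approximations show every edge
   of an inscribed polygon to be far from f(c), and it stops because f(c) is at
   positive distance from g.  Bisection on the parity of side(f(c)) gives a
   computable real s such that side o f is not locally constant at s, hence
   f(s) is on g. *)

Require Import Defs.
From mathcomp Require Import all_boot all_order all_algebra.
From mathcomp Require Import boolp classical_sets reals set_interval.
From mathcomp Require Import zify lra.

Set Implicit Arguments.
Unset Strict Implicit.
Unset Printing Implicit Defensive.

Import Order.TTheory GRing.Theory Num.Theory.

(** * Recursive functions *)

Lemma recursive_eq k (f g : k.-tuple nat -> nat) :
  f =1 g -> recursive f -> recursive g.
Proof. by move=> /funext ->. Qed.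

Lemma recursive_nth k i : recursive (fun v : k.-tuple nat => nth 0 v i).
Proof.
have [ltik | leki] := ltnP i k.
  apply: recursive_eq (rec_proj (Ordinal ltik)) => v.
  by rewrite (tnth_nth 0).
apply: recursive_eq (rec_zero k) => v.
by rewrite nth_default ?size_tuple.
Qed.

Lemma recursive_nth_behead k i :
  recursive (fun v : k.+1.-tuple nat => nth 0 (behead_tuple v) i).
Proof.
apply: recursive_eq (recursive_nth k.+1 i.+1) => v.
by rewrite /= nth_behead.
Qed.

(** Composition with a tuple-valued map, read through [nth] so that no ordinal occurs. Indices
    beyond the length give the constant 0, so quantifying over all [i] asks for nothing more. *)
Lemma recursive_comp k m (f : m.-tuple nat -> nat) (e : k.-tuple nat -> m.-tuple nat) :
  recursive f -> (forall i, recursive (fun v => nth 0 (e v) i)) ->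
  recursive (fun v => f (e v)).
Proof.
move=> rf re.
apply: recursive_eq (rec_comp rf (fun i : 'I_m => re i)) => v.
congr f; apply: eq_from_tnth => i.
by rewrite tnth_mktuple (tnth_nth 0).
Qed.

Definition recursive1 (f : nat -> nat) :=
  recursive (fun v : 1.-tuple nat => f (nth 0 v 0)).

Definition recursive2 (f : nat -> nat -> nat) :=
  recursive (fun v : 2.-tuple nat => f (nth 0 v 0) (nth 0 v 1)).

Lemma recursive_zero k : recursive (fun _ : k.-tuple nat => 0).
Proof. exact: rec_zero. Qed.

Lemma recursive_comp1 k (f : nat -> nat) (e : k.-tuple nat -> nat) :
  recursive1 f -> recursive e -> recursive (fun v => f (e v)).
Proof.
move=> rf re.
apply: (recursive_comp (e := fun v => [tuple e v])) rf _ => -[|i] //=.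
by apply: recursive_eq (recursive_zero k) => v; rewrite nth_default.
Qed.

Lemma recursive_comp2 k (f : nat -> nat -> nat) (e1 e2 : k.-tuple nat -> nat) :
  recursive2 f -> recursive e1 -> recursive e2 ->
  recursive (fun v => f (e1 v) (e2 v)).
Proof.
move=> rf re1 re2.
apply: (recursive_comp (e := fun v => [tuple e1 v; e2 v])) rf _ => -[|[|i]] //=.
by apply: recursive_eq (recursive_zero k) => v; rewrite nth_default.
Qed.

Lemma recursive_curry1 (f : 1.-tuple nat -> nat) :
  recursive f -> recursive1 (fun m => f [tuple m]).
Proof.
apply: recursive_eq => v; congr f; apply: eq_from_tnth => i.
by rewrite !(tnth_nth 0) ord1.
Qed.

Lemma recursive_curry2 (f : 2.-tuple nat -> nat) :
  recursive f -> recursive2 (fun m n => f [tuple m; n]).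
Proof.
apply: recursive_eq => v; congr f; apply: eq_from_tnth => i.
by rewrite !(tnth_nth 0); case: i => [[|[|[]]]].
Qed.

Lemma recursive_succ k (e : k.-tuple nat -> nat) :
  recursive e -> recursive (fun v => (e v).+1).
Proof.
move=> re; apply: (@recursive_comp1 k succn) => //.
apply: recursive_eq rec_succ => v.
by rewrite /thead (tnth_nth 0).
Qed.

Lemma recursive_const k n : recursive (fun _ : k.-tuple nat => n).
Proof. by elim: n => [|n IHn]; [exact: recursive_zero | exact: recursive_succ]. Qed.

(** Primitive recursion packaged as iteration: [it] takes its counter from the head of the tuple,
    and the parameters are what remains. The arithmetic below is obtained by writing each function
    as such an iteration. *)
Lemma recursive_iteri k (n c : k.-tuple nat -> nat)
    (h : nat -> nat -> k.-tuple nat -> nat) :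
  recursive n -> recursive c ->
  recursive (fun v : k.+2.-tuple nat =>
    h (nth 0 v 0) (nth 0 (behead_tuple v) 0) (behead_tuple (behead_tuple v))) ->
  recursive (fun v => iteri (n v) (fun i r => h i r v) (c v)).
Proof.
move=> rn rc rh.
pose it (w : k.+1.-tuple nat) :=
  iteri (nth 0 w 0) (fun i r => h i r (behead_tuple w)) (c (behead_tuple w)).
have consK m (v : k.-tuple nat) : behead_tuple [tuple of m :: v] = v.
  exact: val_inj.
have consK2 m p (v : k.-tuple nat) :
    behead_tuple (behead_tuple [tuple of [:: m, p & v]]) = v.
  exact: val_inj.
have rit : recursive it.
  apply: (rec_prim rc rh) => [v | m v]; first by rewrite /it consK.
  by rewrite /it consK2 !consK.
have e : (fun v => it [tuple of n v :: v]) =1 (fun v => iteri (n v) (fun i r => h i r v) (c v)).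
  by move=> v; rewrite /it consK.
apply: (recursive_eq e); apply: (recursive_comp (e := fun v => [tuple of n v :: v])) => // -[|i] //=.
exact: recursive_nth.
Qed.

Lemma recursive_addn k (e1 e2 : k.-tuple nat -> nat) :
  recursive e1 -> recursive e2 -> recursive (fun v => e1 v + e2 v).
Proof.
move=> r1 r2; apply: (@recursive_eq k (fun v => iteri (e1 v) (fun _ => succn) (e2 v))).
  by move=> v; elim: (e1 v) => //= n ->.
apply: (recursive_iteri (h := fun _ r _ => r.+1)) => //.
by apply: recursive_succ; exact: recursive_nth_behead.
Qed.

(** Bounded sums of truth values stand in for bounded search and bounded quantification: quotients,
    square roots, crossings and failed tests are all counted this way. *)
Lemma recursive_sum k (n : k.-tuple nat -> nat) (F : nat -> k.-tuple nat -> nat) :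
  recursive n ->
  recursive (fun v : k.+1.-tuple nat => F (nth 0 v 0) (behead_tuple v)) ->
  recursive (fun v => \sum_(i < n v) F i v).
Proof.
move=> rn rF; apply: (@recursive_eq k
    (fun v => iteri (n v) (fun i r => r + F i v) 0)).
  by move=> v; elim: (n v) => [|m]; rewrite ?big_ord0 // big_ord_recr /= => ->.
apply: (recursive_iteri (h := fun i r v => r + F i v)) => //.
  exact: recursive_zero.
apply: recursive_addn; first exact: recursive_nth_behead.
pose e (v : k.+2.-tuple nat) := [tuple of nth 0 v 0 :: behead_tuple (behead_tuple v)].
have := recursive_comp (e := e) rF.
have consK v : behead_tuple (e v) = behead_tuple (behead_tuple v).
  exact: val_inj.
under eq_fun do rewrite consK.
apply=> -[|i]; first exact: recursive_nth.
by apply: recursive_eq (recursive_nth k.+2 i.+2) => v; rewrite /= !nth_behead.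
Qed.

Lemma recursive_muln k (e1 e2 : k.-tuple nat -> nat) :
  recursive e1 -> recursive e2 -> recursive (fun v => e1 v * e2 v).
Proof.
move=> r1 r2; apply: (@recursive_eq k (fun v => \sum_(i < e1 v) e2 v)).
  by move=> v; rewrite sum_nat_const card_ord.
apply: (recursive_sum (F := fun _ => e2)) => //.
apply: (recursive_comp (e := @behead_tuple k.+1 nat)) => // i.
exact: recursive_nth_behead.
Qed.

Lemma recursive_pred k (e : k.-tuple nat -> nat) :
  recursive e -> recursive (fun v => (e v).-1).
Proof.
move=> re; apply: (@recursive_eq k (fun v => iteri (e v) (fun i _ => i) 0)).
  by move=> v; case: (e v).
apply: (recursive_iteri (h := fun i _ _ => i)) => //; first exact: recursive_zero.
exact: recursive_nth.
Qed.

Lemma recursive_subn k (e1 e2 : k.-tuple nat -> nat) :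
  recursive e1 -> recursive e2 -> recursive (fun v => e1 v - e2 v).
Proof.
move=> r1 r2; apply: (@recursive_eq k (fun v => iteri (e2 v) (fun _ => predn) (e1 v))).
  by move=> v; elim: (e2 v) => [|n /= ->]; rewrite ?subn0 ?subnS.
apply: (recursive_iteri (h := fun _ r _ => r.-1)) => //.
by apply: recursive_pred; exact: recursive_nth_behead.
Qed.

Lemma recursive_expn k a (e : k.-tuple nat -> nat) :
  recursive e -> recursive (fun v => a ^ e v).
Proof.
move=> re; apply: (@recursive_eq k (fun v => iteri (e v) (fun _ r => r * a) 1)).
  by move=> v; elim: (e v) => //= n ->; rewrite expnSr.
apply: (recursive_iteri (h := fun _ r _ => r * a)) => //; first exact: recursive_const.
by apply: recursive_muln; [exact: recursive_nth_behead | exact: recursive_const].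
Qed.

Lemma recursive_leq k (e1 e2 : k.-tuple nat -> nat) :
  recursive e1 -> recursive e2 -> recursive (fun v => e1 v <= e2 v).
Proof.
move=> r1 r2; apply: (@recursive_eq k (fun v => 1 - (e1 v - e2 v))).
  by move=> v; rewrite /leq; case: (e1 v - e2 v).
by do 2?[apply: recursive_subn]; rewrite //; exact: recursive_const.
Qed.

Lemma recursive_negb k (b : k.-tuple nat -> bool) : recursive b ->
  recursive (fun v => ~~ b v).
Proof.
move=> rb; apply: (@recursive_eq k (fun v => 1 - b v)); first by move=> v; case: (b v).
by apply: recursive_subn => //; exact: recursive_const.
Qed.

Lemma recursive_andb k (b1 b2 : k.-tuple nat -> bool) :
  recursive b1 -> recursive b2 -> recursive (fun v => b1 v && b2 v).
Proof.
move=> r1 r2; apply: (@recursive_eq k (fun v => b1 v * b2 v)).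
  by move=> v; rewrite mulnb.
exact: recursive_muln.
Qed.

Lemma recursive_behead k (e : k.-tuple nat -> nat) :
  recursive e -> recursive (fun v : k.+1.-tuple nat => e (behead_tuple v)).
Proof.
move=> re; apply: (recursive_comp (e := @behead_tuple k.+1 nat)) => // i.
exact: recursive_nth_behead.
Qed.

Lemma sum_ltn m n : m <= n -> \sum_(i < n) (i < m) = m.
Proof.
have -> : \sum_(i < n) (i < m) = minn m n.
  by elim: n => [|n IHn]; rewrite ?big_ord0 ?minn0 // big_ord_recr /= IHn; lia.
by move/minn_idPl.
Qed.

Lemma recursive_divn k (e1 e2 : k.-tuple nat -> nat) :
  recursive e1 -> recursive e2 -> recursive (fun v => e1 v %/ e2 v).
Proof.
move=> r1 r2.
(* The quotient is the number of positive multiples of the divisor up to the dividend; the guard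
   matches the convention that division by 0 gives 0. *)
apply: (@recursive_eq k (fun v => \sum_(i < e1 v) ((0 < e2 v) && (i.+1 * e2 v <= e1 v)))).
  move=> v; case: (posnP (e2 v)) => [-> | e2_gt0] /=.
    by rewrite divn0 big1.
  under eq_bigr do rewrite -leq_divRL //.
  by rewrite sum_ltn ?leq_div.
apply: (recursive_sum (F := fun i v => (0 < e2 v) && (i.+1 * e2 v <= e1 v))) => //.
apply: recursive_andb.
  by apply: recursive_leq; [exact: recursive_const | exact: recursive_behead].
apply: recursive_leq; last exact: recursive_behead.
apply: recursive_muln; last exact: recursive_behead.
by apply: recursive_succ; exact: recursive_nth.
Qed.

Lemma recursive_odd k (e : k.-tuple nat -> nat) :
  recursive e -> recursive (fun v => odd (e v)).
Proof.
move=> re; apply: (@recursive_eq k (fun v => e v - e v %/ 2 * 2)).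
  by move=> v; rewrite -modn2 {1}(divn_eq (e v) 2) addKn.
apply: recursive_subn => //; apply: recursive_muln; last exact: recursive_const.
by apply: recursive_divn => //; exact: recursive_const.
Qed.

(** Unbounded search: [ex_minn] selects the least zero, and [rec_min] applies because the search
    succeeds for every [q]. *)
Lemma recursive_min (B : nat -> nat -> nat) :
  recursive2 B -> (forall q, exists m, B m q = 0) ->
  exists2 M, recursive1 M & forall q, B (M q) q = 0.
Proof.
move=> rB B0.
have B0b q : exists m, B m q == 0 by have [m /eqP] := B0 q; exists m.
exists (fun q => ex_minn (B0b q)); last by move=> q; case: ex_minnP => m /eqP.
apply: (rec_min rB) => v /=.
case: ex_minnP => m /eqP Bm minm; split=> // l ltlm /eqP /minm.
by rewrite leqNgt ltlm.
Qed.

Lemma recursive_addb k (b1 b2 : k.-tuple nat -> bool) :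
  recursive b1 -> recursive b2 -> recursive (fun v => b1 v (+) b2 v).
Proof.
move=> r1 r2; apply: (@recursive_eq k (fun v => odd (b1 v + b2 v))).
  by move=> v; rewrite oddD !oddb.
by apply: recursive_odd; apply: recursive_addn.
Qed.

Ltac recursive_tac :=
  repeat first [ exact: recursive_nth | exact: recursive_nth_behead
  | match goal with
    | h : recursive2 ?f |- recursive (fun v => ?f _ _) => apply: (recursive_comp2 h)
    | h : recursive1 ?f |- recursive (fun v => ?f _) => apply: (recursive_comp1 h)
    | h : recursive1 (fun x => nat_of_bool (?f x)) |- recursive (fun v => nat_of_bool (?f _)) =>
      apply: (recursive_comp1 h)
    end
  | exact: recursive_const
  | apply: recursive_addb | apply: recursive_andb | apply: recursive_leq
  | apply: recursive_odd | apply: recursive_expn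
  | apply: recursive_succ | apply: recursive_addn | apply: recursive_subn
  | apply: recursive_muln ].

(** * Enumeration of the rational numbers of the unit interval *)

Definition isqrt n := \sum_(i < n) (i.+1 * i.+1 <= n).

Lemma isqrt_eq n i : i <= n -> isqrt (n * n + i) = n.
Proof.
move=> lein; rewrite /isqrt.
have E (j : 'I_(n * n + i)) : (j.+1 * j.+1 <= n * n + i) = (j < n).
  by apply/idP/idP; nia.
under eq_bigr do rewrite E.
by apply: sum_ltn; nia.
Qed.

(* Every rational number [i / n] of the unit interval is the term of index
   [n * n + i] of the sequence [unit_num q / unit_den q]. *)
Definition unit_num q := q - isqrt q * isqrt q - (q - isqrt q * isqrt q - isqrt q).
Definition unit_den q := (isqrt q).-1.+1.

Lemma recursive_isqrt : recursive1 isqrt.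
Proof.
apply: (recursive_sum (F := fun i v => i.+1 * i.+1 <= nth 0 v 0)).
  exact: recursive_nth.
apply: recursive_leq; last exact: recursive_nth_behead.
by apply: recursive_muln; apply: recursive_succ; exact: recursive_nth.
Qed.

Lemma recursive_unit_num : recursive1 unit_num.
Proof.
have r0 := recursive_nth 1 0; have r1 := recursive_isqrt.
have r2 : recursive (fun v : 1.-tuple nat => nth 0 v 0 - isqrt (nth 0 v 0) * isqrt (nth 0 v 0)).
  by apply: recursive_subn => //; apply: recursive_muln.
by do 2!apply: recursive_subn => //.
Qed.

Lemma recursive_unit_den : recursive1 unit_den.
Proof. by apply: recursive_succ; apply: recursive_pred; exact: recursive_isqrt. Qed.

Lemma unit_numE n i : i <= n -> unit_num (n * n + i) = i.
Proof. by move=> lein; rewrite /unit_num isqrt_eq // addKn; lia. Qed.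

Lemma unit_denE n i : i <= n -> 0 < n -> unit_den (n * n + i) = n.
Proof. by move=> lein n_gt0; rewrite /unit_den isqrt_eq // prednK. Qed.

(** The double truncated subtraction in [unit_num] is the minimum of [q - isqrt q * isqrt q] and
    [isqrt q], so every index yields a number of the unit interval; [.-1.+1] keeps the denominator
    positive at [q = 0]. *)
Lemma leq_unit_num q : unit_num q <= unit_den q.
Proof. by rewrite /unit_num /unit_den; lia. Qed.

Local Open Scope ring_scope.

Definition unit_seq (R : realType) (q : nat) : R := (unit_num q)%:R / (unit_den q)%:R.

Lemma unit_seqE (R : realType) n i :
  (i <= n)%N -> (0 < n)%N -> unit_seq R (n * n + i)%N = i%:R / n%:R.
Proof. by move=> *; rewrite /unit_seq unit_numE // unit_denE. Qed.

Lemma unit_seq_itv (R : realType) q : 0 <= unit_seq R q <= 1.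
Proof.
rewrite divr_ge0 ?ler0n //= ler_pdivrMr ?ltr0n // mul1r ler_nat.
exact: leq_unit_num.
Qed.

Lemma ratr_frac (R : realType) (m n : nat) :
  ratr (m%:R / n%:R) = m%:R / n%:R :> R.
Proof. by rewrite fmorph_div !rmorph_nat. Qed.

Lemma computable_unit_seq (R : realType) : computable_seq (unit_seq R).
Proof.
exists (fun v => (unit_num (nth 0%N v 0))%:R / (unit_den (nth 0%N v 0))%:R); split.
  exists (fun=> 0%N), (fun v => unit_num (nth 0%N v 0)), (fun v => unit_den (nth 0%N v 0)).
  split=> [|||v].
  - exact: recursive_zero.
  - exact: (recursive_comp1 recursive_unit_num) (recursive_nth _ _).
  - exact: (recursive_comp1 recursive_unit_den) (recursive_nth _ _).
  - by rewrite expr0 mul1r.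
by move=> m n; rewrite ratr_frac subrr normr0 invr_ge0 exprn_ge0.
Qed.

(** * Computable reals and sequences, and approximation by natural numbers *)

Lemma computable_seq_const (R : realType) (x : R) :
  computable_real x -> computable_seq (fun=> x).
Proof.
move=> [r [[s [a [b [rs ra rb rE]]]] xr]].
exists (fun v => r [tuple nth 0%N v 1]); split; last by move=> m n; exact: xr.
have rc e : recursive e -> recursive (fun v : 2.-tuple nat => e [tuple nth 0%N v 1]).
  move=> re; apply: (recursive_comp1 (recursive_curry1 re)).
  exact: recursive_nth.
by exists (fun v => s [tuple nth 0%N v 1]), (fun v => a [tuple nth 0%N v 1]),
  (fun v => b [tuple nth 0%N v 1]); split; rewrite //; exact: rc.
Qed.

Lemma computable_real_term (R : realType) (x : nat -> R) q :
  computable_seq x -> computable_real (x q).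
Proof.
move=> [r [[s [a [b [rs ra rb rE]]]] xr]].
exists (fun v => r [tuple q; nth 0%N v 0]); split; last by move=> n; exact: xr.
have rc e : recursive e -> recursive (fun v : 1.-tuple nat => e [tuple q; nth 0%N v 0]).
  move=> re; apply: (recursive_comp2 (recursive_curry2 re)).
    exact: recursive_const.
  exact: recursive_nth.
by exists (fun v => s [tuple q; nth 0%N v 0]), (fun v => a [tuple q; nth 0%N v 0]),
  (fun v => b [tuple q; nth 0%N v 0]); split; rewrite //; exact: rc.
Qed.

Lemma computable_real_dyadic (R : realType) (x : R) (X : nat -> nat) :
  recursive1 X -> (forall n, `|(X n)%:R / 2 ^+ n - x| <= 2 ^- n) -> computable_real x.
Proof.
move=> rX Xx; exists (fun v => (X (nth 0%N v 0))%:R / (2 ^ nth 0%N v 0)%:R); split.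
  exists (fun=> 0%N), (fun v => X (nth 0%N v 0)), (fun v => 2 ^ nth 0%N v 0)%N.
  split=> // [||v].
  - exact: recursive_zero.
  - by apply: recursive_expn; exact: recursive_nth.
  - by rewrite expr0 mul1r; split=> //; apply/eqP; rewrite expn_eq0.
by move=> n; rewrite ratr_frac natrX; exact: Xx.
Qed.

(** Scaled by [2 ^ m], the rational approximation of precision [m] has error at most 1, and rounding
    down costs at most 1 more. A negative approximation is replaced by 0, which is harmless since
    [y q] is nonnegative. *)
Lemma computable_seq_nat_approx (R : realType) (y : nat -> R) :
  computable_seq y -> (forall q, 0 <= y q) ->
  exists2 G, recursive2 G & forall q m, `|(G q m)%:R - 2 ^+ m * y q| <= 2.
Proof.
move=> [r [[s [a [b [rs ra rb rE]]]] yr]] y_ge0.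
exists (fun q m => (~~ odd (s [tuple q; m]) * ((a [tuple q; m] * 2 ^ m) %/ b [tuple q; m]))%N).
  have rc e : recursive e -> recursive (fun v : 2.-tuple nat => e [tuple nth 0%N v 0; nth 0%N v 1]).
    exact: recursive_curry2.
  apply: recursive_muln; first by apply: recursive_negb; apply: recursive_odd; exact: rc.
  apply: recursive_divn; last exact: rc.
  apply: recursive_muln; first exact: rc.
  by apply: recursive_expn; exact: recursive_nth.
move=> q m; have := yr q m; have [/eqP b_neq0 ->] := rE [tuple q; m].
set S := s _; set A := a _; set B := b _ in b_neq0 *.
rewrite rmorphM rmorph_sign fmorph_div !rmorph_nat -signr_odd.
have p_gt0 : 0 < 2 ^+ m :> R by rewrite exprn_gt0.
have B_gt0 : 0 < B%:R :> R by rewrite ltr0n lt0n.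
set P := 2 ^+ m in p_gt0 *.
have H z : `|z - y q| <= P^-1 -> `|P * z - P * y q| <= 1.
  by rewrite -mulrBr normrM gtr0_norm // => h; rewrite -ler_pdivlMl // mulr1.
move/H; have := y_ge0 q => yq.
have Py : 0 <= P * y q by rewrite mulr_ge0 // ltW.
have AB : 0 <= P * (A%:R / B%:R) by rewrite mulr_ge0 ?divr_ge0 // ltW.
case: odd; rewrite ?mulN1r ?mul1r ?mul0n ?mul1n !ler_norml => /andP[h1 h2].
  by lra.
have : (A * 2 ^ m)%:R = ((A * 2 ^ m) %/ B)%:R * B%:R + ((A * 2 ^ m) %% B)%:R :> R.
  by rewrite -natrM -natrD -divn_eq.
have : ((A * 2 ^ m) %% B)%:R < B%:R :> R by rewrite ltr_nat ltn_pmod // lt0n.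
have : 0 <= ((A * 2 ^ m) %% B)%:R :> R by [].
set Q := ((A * 2 ^ m) %/ B)%:R; set M := (_ %% _)%:R => M0 MB.
rewrite natrM natrX -/P => E.
have {}E : P * (A%:R / B%:R) = Q + M / B%:R.
  by rewrite mulrA [P * _]mulrC E mulrDl mulfK ?gt_eqF.
have : 0 <= M / B%:R < 1 by rewrite divr_ge0 //= ?ltr_pdivrMr ?mul1r // ltW.
by rewrite E in h1 h2 *; move=> /andP[]; lra.
Qed.

(** * Parity of crossings *)

Definition crossings (a b : nat -> bool) n := (\sum_(i < n) ((a i (+) a i.+1) && b i))%N.

Lemma odd_crossingsS (a b : nat -> bool) n :
  odd (crossings a b n.+1) = odd (crossings a b n) (+) ((a n (+) a n.+1) && b n).
Proof. by rewrite /crossings big_ord_recr /= oddD oddb. Qed.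

(** A discrete homotopy invariance: in the strip between two polygons, each cell has constant [a]
    labels or constant [b] labels, so an even number of its sides cross the ray. *)
Lemma odd_crossings_eq (a b a' b' : nat -> bool) n :
  (forall i, (i < n)%N ->
    [/\ a i.+1 = a i, a' i = a i & a' i.+1 = a i] \/
    [/\ b i.+1 = b i, b' i = b i & b' i.+1 = b i]) ->
  ~~ a 0%N -> ~~ a' 0%N -> ~~ b n ->
  odd (crossings a b n) = odd (crossings a' b' n).
Proof.
move=> cell /negbTE a0 /negbTE a'0 /negbTE bn.
(* The right-hand side is the crossing of the rung joining the two vertices of index [m]. It
   vanishes at both ends, since neither path starts on the right and the first one does not end
   above. *)
suff E m : (m <= n)%N ->
    odd (crossings a b m) (+) odd (crossings a' b' m) = (a m (+) a' m) && b m.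
  by have := E n (leqnn n); rewrite bn andbF; do 2!case: (odd _).
elim: m => [|m IHm] ltmn; first by rewrite /crossings !big_ord0 a0 a'0.
rewrite !odd_crossingsS addbACA IHm ?(ltnW ltmn) //.
have [[-> -> ->]|[-> -> _]] := cell m ltmn.
  by rewrite !addbb.
by case: (a m) (a m.+1) (a' m) (a' m.+1) (b m) => [] [] [] [] [].
Qed.

(** Repeating each vertex [K] times only adds edges that do not change sides; the last edge of each
    block is the original one. Polygons with [n] and [n * K] edges can thus be compared edge by
    edge. *)
Lemma crossings_lift (a b : nat -> bool) n K : (0 < K)%N ->
  crossings (fun i => a (i %/ K)%N) (fun i => b (i %/ K)%N) (n * K)%N = crossings a b n.
Proof.
case: K => // K _; elim: n => [|n IHn]; first by rewrite /crossings !big_ord0.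
have -> : (n.+1 * K.+1 = n * K.+1 + K.+1)%N by rewrite mulSn addnC.
rewrite [RHS]big_ord_recr /= -/(crossings a b n) -IHn /crossings big_split_ord /=.
congr addn.
have shift i : (i < K.+1)%N -> ((n * K.+1 + i) %/ K.+1 = n)%N.
  by move=> ltiK; rewrite divnMDl // divn_small // addn0.
rewrite big_ord_recr big1 /= => [|i _].
  by rewrite shift // -addnS -mulSnr mulnK.
by rewrite -addnS !shift ?addbb // ltnS // ltnW // ltn_ord.
Qed.

Lemma lt0_near (R : realDomainType) (c x y d : R) :
  d <= `|c| -> `|x - c| < d -> `|y - c| < d -> (0 < x) = (0 < y).
Proof.
rewrite !ltr_norml => dc /andP[x1 x2] /andP[y1 y2].
have [c_gt0 | c_le0] := ltrP 0 c.
  rewrite gtr0_norm // in dc.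
  by transitivity true; [|symmetry]; apply/idP; lra.
rewrite ler0_norm // in dc.
by transitivity false; [|symmetry]; apply/negbTE; rewrite -leNgt; lra.
Qed.

(* [c] is a reference path, moving by steps, from which both [x] and [y] stay
   closer than [c] stays to the origin. *)
Lemma odd_crossings_near (R : realDomainType) (c1 c2 x1 x2 y1 y2 : nat -> R) d n :
  (forall i, (i < n)%N -> d <= `|c1 i| \/ d <= `|c2 i|) ->
  (forall i j, (i < n)%N -> (i <= j <= i.+1)%N ->
    [/\ `|x1 j - c1 i| < d, `|x2 j - c2 i| < d, `|y1 j - c1 i| < d & `|y2 j - c2 i| < d]) ->
  x1 0%N <= 0 -> y1 0%N <= 0 -> x2 n <= 0 ->
  odd (crossings (fun i => 0 < x1 i) (fun i => 0 < x2 i) n) =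
  odd (crossings (fun i => 0 < y1 i) (fun i => 0 < y2 i) n).
Proof.
move=> away near x0 y0 xn; apply: odd_crossings_eq; rewrite -?leNgt // => i ltin.
have [|a1 a2 a3 a4] := near i i ltin; first by rewrite leqnn leqnSn.
have [|b1 b2 b3 b4] := near i i.+1 ltin; first by rewrite leqnn leqnSn.
by have [dc|dc] := away i ltin; [left | right]; split; apply: lt0_near dc _ _.
Qed.

(** * The side of a point with respect to a path, exact and approximate *)

Section Side.
Variable R : realType.
Implicit Types (g : R -> R * R) (p q : R * R).

(* Parity of the crossings of an inscribed polygon with the ray going up from
   [p]: an edge counts when it changes sides of the vertical line through [p]
   and starts above [p]. *)
Definition side g p n := odd (crossings
  (fun i => 0 < (g (i%:R / n%:R)).1 - p.1) (fun i => 0 < (g (i%:R / n%:R)).2 - p.2) n).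

Definition modulus_at (h : R -> R) (d e : R) := forall s t : R,
  0 <= s <= 1 -> 0 <= t <= 1 -> `|s - t| <= d -> `|h s - h t| <= e.

Lemma frac_itv i n : (i <= n)%N -> 0 <= (i%:R / n%:R : R) <= 1.
Proof.
(* For [n = 0] the quotient is 0 by convention. *)
case: n => [|n] lein; first by rewrite invr0 mulr0 lexx ler01.
by rewrite divr_ge0 //= ler_pdivrMr ?ltr0n // mul1r ler_nat.
Qed.

Lemma frac_step i j n : (i <= j <= i.+1)%N -> `|j%:R / n%:R - i%:R / n%:R| <= n%:R^-1 :> R.
Proof.
case/andP=> ij ji; rewrite -mulrBl -natrB // normrM ger0_norm //.
rewrite ger0_norm ?invr_ge0 // ler_piMl ?invr_ge0 // lern1; lia.
Qed.

Section Ends.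
Variables (g : R -> R * R).
Hypotheses (g0 : g 0 = (0, 1)) (g1 : g 1 = (1, 0)).

(** The reference path is [g - q]. Moving along an edge costs at most [d / 4] and replacing [q] by
    [p] or [p'] as much again, which stays below [d]. The signs imposed on [p] and [p'] put the
    start of [g] not to their right and its end not above [p]. *)
Lemma side_near p p' q d n : (0 < n)%N ->
  0 <= p.1 -> 0 <= p.2 -> 0 <= p'.1 ->
  (forall t, 0 <= t <= 1 -> d <= `|(g t).1 - q.1| \/ d <= `|(g t).2 - q.2|) ->
  `|p.1 - q.1| <= d / 4 -> `|p.2 - q.2| <= d / 4 ->
  `|p'.1 - q.1| <= d / 4 -> `|p'.2 - q.2| <= d / 4 -> 0 < d ->
  modulus_at (fun t => (g t).1) n%:R^-1 (d / 4) ->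
  modulus_at (fun t => (g t).2) n%:R^-1 (d / 4) ->
  side g p n = side g p' n.
Proof.
move=> n_gt0 p1 p2 p1' away pq1 pq2 pq1' pq2' d_gt0 m1 m2.
have n_neq0 : n%:R != 0 :> R by rewrite pnatr_eq0 -lt0n.
apply: (odd_crossings_near (d := d) (c1 := fun i => (g (i%:R / n%:R)).1 - q.1)
  (c2 := fun i => (g (i%:R / n%:R)).2 - q.2)).
- by move=> i ltin; apply: away; apply: frac_itv; apply: ltnW.
- move=> i j ltin ij.
  have ti := frac_itv (ltnW ltin).
  have tj : 0 <= (j%:R / n%:R : R) <= 1 by case/andP: ij => _ ji; apply: frac_itv; exact: leq_trans ji ltin.
  have near (u v x y : R) : `|x - y| <= d / 4 -> `|v - u| <= d / 4 ->
      `|v - x - (u - y)| < d.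
    by rewrite !ler_norml ltr_norml => /andP[? ?] /andP[? ?]; lra.
  have h1 := m1 _ _ tj ti (frac_step _ ij); have h2 := m2 _ _ tj ti (frac_step _ ij).
  by split; apply: near.
- by rewrite mul0r g0 /=; lra.
- by rewrite mul0r g0 /=; lra.
- by rewrite divff // g1 /=; lra.
Qed.

(* [G1 0 - F1] may be positive although [g 0] is not to the right of [p]; the
   shift by 5 exceeds its error, so that the approximate polygon also starts
   with a vertex labelled as not being on the right. *)
Lemma side_approx p m n K (F1 F2 : nat) (G1 G2 : nat -> nat) :
  (0 < n)%N -> (0 < K)%N -> 0 <= p.1 -> 0 <= p.2 ->
  `|F1%:R - 2 ^+ m * p.1| <= 2 -> `|F2%:R - 2 ^+ m * p.2| <= 2 ->
  (forall i, (i <= n)%N -> `|(G1 i)%:R - 2 ^+ m * (g (i%:R / n%:R)).1| <= 2) ->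
  (forall i, (i <= n)%N -> `|(G2 i)%:R - 2 ^+ m * (g (i%:R / n%:R)).2| <= 2) ->
  modulus_at (fun t => (g t).1) n%:R^-1 (2 ^- m) ->
  modulus_at (fun t => (g t).2) n%:R^-1 (2 ^- m) ->
  (forall i, (i < n)%N ->
    12 <= `|(G1 i)%:R - F1%:R : R| \/ 12 <= `|(G2 i)%:R - F2%:R : R|) ->
  side g p (n * K) =
  odd (crossings (fun i => F1 + 5 < G1 i)%N (fun i => F2 + 5 < G2 i)%N n).
Proof.
move=> n_gt0 K_gt0 p1 p2 F1p F2p G1g G2g m1 m2 away.
have P_gt0 : 0 < 2 ^+ m :> R by rewrite exprn_gt0.
have scale (h : R -> R) : modulus_at h n%:R^-1 (2 ^- m) -> forall s t,
    0 <= s <= 1 -> 0 <= t <= 1 -> `|s - t| <= n%:R^-1 ->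
    `|2 ^+ m * h s - 2 ^+ m * h t| <= 1.
  move=> mh s t s01 t01 st; rewrite -mulrBr normrM gtr0_norm //.
  by rewrite -ler_pdivlMl // mulr1; exact: mh.
have {m1}m1 := scale _ m1; have {m2}m2 := scale _ m2.
(* Both polygons now have [n * K] edges. The reference path stays at the approximate coarse vertex
   throughout each block of [K] edges. *)
rewrite -[in RHS](crossings_lift _ _ n K_gt0).
have lab (F G : nat) : (F + 5 < G)%N = (0 < G%:R - F%:R - 5 :> R).
  by rewrite -(ltr_nat R) natrD -addrA -opprD subr_gt0.
have nK_neq0 : (n * K)%:R != 0 :> R by rewrite pnatr_eq0 -lt0n muln_gt0 n_gt0.
transitivity (odd (crossings
    (fun i => 0 < 2 ^+ m * (g (i%:R / (n * K)%:R)).1 - 2 ^+ m * p.1)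
    (fun i => 0 < 2 ^+ m * (g (i%:R / (n * K)%:R)).2 - 2 ^+ m * p.2) (n * K))).
  by congr (odd (crossings _ _ _)); apply/funext => i; rewrite -mulrBr pmulr_rgt0.
under [in RHS]eq_fun do rewrite lab.
under [X in _ = odd (crossings _ X _)]eq_fun do rewrite lab.
apply: (odd_crossings_near (d := 12) (c1 := fun i => (G1 (i %/ K)%N)%:R - F1%:R)
  (c2 := fun i => (G2 (i %/ K)%N)%:R - F2%:R)).
- by move=> i ltin; apply: away; rewrite ltn_divLR.
- move=> i j ltin ij; set k := (i %/ K)%N.
  have ltkn : (k < n)%N by rewrite ltn_divLR.
  have [ki lik] : (k * K <= i)%N /\ (i < k.+1 * K)%N.
    by rewrite leq_divM -ltn_divLR.
  have [lij lji] := andP ij.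
  have ljk : (j <= k.+1 * K)%N := leq_trans lji lik.
  have kj : (k <= j %/ K <= k.+1)%N.
    rewrite leq_div2r //= -ltnS ltn_divLR //; apply: leq_ltn_trans ljk _.
    by rewrite [ltnRHS]mulSn -[ltnLHS]add0n ltn_add2r.
  have ljn : (j %/ K <= n)%N by case/andP: kj => _ /leq_trans; exact.
  have tk : 0 <= (k%:R / n%:R : R) <= 1 by apply: frac_itv; apply: ltnW.
  have tk' : 0 <= ((j %/ K)%:R / n%:R : R) <= 1 by exact: frac_itv.
  have tj : 0 <= (j%:R / (n * K)%:R : R) <= 1.
    by apply: frac_itv; exact: leq_trans lji ltin.
  (* Since [k * K <= j <= k.+1 * K], the fine parameter lies between the coarse ones of index [k]
     and [k.+1]. *)
  have jk : `|j%:R / (n * K)%:R - k%:R / n%:R| <= n%:R^-1 :> R.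
    have -> : k%:R / n%:R = (k * K)%:R / (n * K)%:R :> R.
      by rewrite !natrM -mulf_div divff ?mulr1 // pnatr_eq0 -lt0n.
    rewrite -mulrBl -natrB; last exact: leq_trans lij.
    rewrite ger0_norm ?divr_ge0 // ler_pdivrMr ?ltr0n ?muln_gt0 ?n_gt0 //.
    rewrite natrM mulrA mulVf ?mul1r ?pnatr_eq0 -?lt0n // ler_nat.
    by rewrite leq_subLR -mulSnr.
  (* Two approximation errors of 2 and a displacement of 1 add up to 5; with the shift by 5 in the
     labels the total is at most 10, hence below 12. *)
  have near (F G G' x u v w : R) : `|F - x| <= 2 -> `|G - u| <= 2 -> `|G' - v| <= 2 ->
      `|v - u| <= 1 -> `|w - u| <= 1 ->
      `|w - x - (G - F)| < 12 /\ `|G' - F - 5 - (G - F)| < 12.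
    rewrite !ler_norml !ltr_norml.
    by do 5!move=> /andP[? ?]; split; lra.
  have [h1 h1'] := near _ _ _ _ _ _ _ F1p (G1g k (ltnW ltkn)) (G1g (j %/ K)%N ljn)
    (m1 _ _ tk' tk (frac_step _ kj)) (m1 _ _ tj tk jk).
  have [h2 h2'] := near _ _ _ _ _ _ _ F2p (G2g k (ltnW ltkn)) (G2g (j %/ K)%N ljn)
    (m2 _ _ tk' tk (frac_step _ kj)) (m2 _ _ tj tk jk).
  by [].
- by rewrite mul0r g0 /= mulr0 sub0r oppr_le0 mulr_ge0 // ltW.
- rewrite div0n; have := G1g 0%N isT; rewrite mul0r g0 /= mulr0 subr0 => /ler_normlP[_ ?].
  have : 0 <= F1%:R :> R by []. lra.
- by rewrite divff // g1 /= mulr0 sub0r oppr_le0 mulr_ge0 // ltW.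
Qed.

End Ends.
End Side.

(** * Bounds and limits *)

Section Reals.
Variable R : realType.

Lemma exp2V_small (e : R) : 0 < e -> exists n, 2 ^- n <= e.
Proof.
move=> e_gt0; exists (Num.bound e^-1).
rewrite -[leRHS]invrK lef_pV2 ?posrE ?exprn_gt0 ?invr_gt0 //.
by apply: ltW; exact: upper_nthrootP.
Qed.

(** Let [c] be the supremum of the [x] such that [h] has a positive lower bound on [[0, x]]. By
    continuity [h] is at least [h c / 2] near [c], so a bound persists slightly beyond [c] unless 1
    is reached. *)
Lemma positive_lower_bound (h : R -> R) :
  (forall t : R, 0 <= t <= 1 -> 0 < h t) ->
  (forall e : R, 0 < e -> exists2 d : R, 0 < d & modulus_at h d e) ->
  exists2 d : R, 0 < d & forall t : R, 0 <= t <= 1 -> d <= h t.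
Proof.
move=> h_gt0 h_cont.
pose S := [set x : R | 0 <= x <= 1 /\
  exists2 d : R, 0 < d & forall t : R, 0 <= t <= x -> d <= h t]%classic.
have S0 : S 0.
  split; first by rewrite lexx ler01.
  exists (h 0); first by apply: h_gt0; rewrite lexx ler01.
  by move=> t; rewrite -eq_le => /eqP <-.
have supS : has_sup S by split; [exists 0 | exists 1 => x [/andP[]]].
have c01 : 0 <= sup S <= 1.
  by rewrite sup_upper_bound //= ge_sup //; [exists 0 | move=> x [/andP[]]].
have /andP[c0 c1] := c01.
have hc := h_gt0 _ c01; set c := sup S in c01 c0 c1 hc *.
have [e e_gt0 he] := h_cont (h c / 2) ltac:(lra).
have [x [/andP[x0 x1] [d d_gt0 hx]] xc] := sup_adherent e_gt0 supS.
pose y := Num.min 1 (c + e).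
have hy : exists2 d : R, 0 < d & forall t : R, 0 <= t <= y -> d <= h t.
  exists (Num.min d (h c / 2)); first by rewrite lt_min d_gt0; lra.
  move=> t /andP[t0]; rewrite /y le_min ge_min => /andP[t1 tc].
  (* Either [t] is covered by the bound on [[0, x]], or [c - e < x < t <= c + e] and continuity at
     [c] applies. *)
  have [tx | xt] := lerP t x; first by rewrite hx ?t0.
  apply/orP; right; have := he t c _ c01; rewrite t0 t1 => /(_ isT).
  rewrite -/c in xc; rewrite !ler_norml => H.
  have /H/andP[? ?] : - e <= t - c <= e by lra.
  by lra.
have yc : y <= c.
  apply: sup_upper_bound => //; split=> //.
  by rewrite /y le_min ge_min lexx ler01 /= andbT; lra.
have y1 : y = 1.
  by move: yc; rewrite /y; case: (ltrP 1 (c + e)) => // _ ?; exfalso; lra.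
by case: hy => d' d'_gt0 hd'; exists d' => //; rewrite -y1.
Qed.

(** The intervals from [X k / 2 ^ k] to [(X k).+1 / 2 ^ k] are nested; the supremum of their left
    ends lies in all of them. *)
Lemma dyadic_nest (X : nat -> nat) :
  X 0%N = 0%N -> (forall k, (X k).*2 <= X k.+1 <= (X k).*2.+1)%N ->
  exists s : R, 0 <= s <= 1 /\
    forall k, (X k)%:R / 2 ^+ k <= s <= (X k).+1%:R / 2 ^+ k.
Proof.
move=> X0 XS.
have p_gt0 k : 0 < 2 ^+ k :> R by rewrite exprn_gt0.
have lo k d : (2 ^ d * X k <= X (d + k))%N.
  elim: d => [|d IHd]; first by rewrite mul1n.
  by have := XS (d + k)%N; rewrite expnS addSn -mulnA; lia.
have up k d : (X (d + k) < 2 ^ d * (X k).+1)%N.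
  elim: d => [|d IHd]; first by rewrite mul1n.
  by have := XS (d + k)%N; rewrite expnS addSn -mulnA; lia.
(* Every left end is at most every right end: compare both at the finer of the two levels. *)
have sep k l : (X k)%:R / 2 ^+ k <= (X l).+1%:R / 2 ^+ l :> R.
  rewrite ler_pdivrMr // mulrAC ler_pdivlMr // -!natrX -!natrM ler_nat.
  have [kl | lk] := leqP k l.
    have := lo k (l - k)%N; rewrite subnK // => h.
    have := leq_mul h (leqnn (2 ^ k)); have -> : (2 ^ l = 2 ^ (l - k) * 2 ^ k)%N.
      by rewrite -expnD subnK.
    nia.
  have := up l (k - l)%N; rewrite (subnK (ltnW lk)) => h.
  have := leq_mul (ltnW h) (leqnn (2 ^ l)); have -> : (2 ^ k = 2 ^ (k - l) * 2 ^ l)%N.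
    by rewrite -expnD subnK // ltnW.
  nia.
pose S : set R := range (fun k => (X k)%:R / 2 ^+ k).
have ubS k : ubound S ((X k).+1%:R / 2 ^+ k : R) by move=> _ [l _ <-].
have S0 : nonempty S by exists ((X 0%N)%:R / 2 ^+ 0), 0%N.
have supS : has_sup S by split => //; exists ((X 0%N).+1%:R / 2 ^+ 0).
have Xs k : (X k)%:R / 2 ^+ k <= sup S <= (X k).+1%:R / 2 ^+ k.
  by rewrite sup_upper_bound ?ge_sup //; exists k.
exists (sup S); split=> //.
by have := Xs 0%N; rewrite X0 expr0 !divr1.
Qed.

Lemma GL_modulus (h : R -> R) : effectively_uniformly_continuous h ->
  forall e : R, 0 < e -> exists2 d : R, 0 < d & modulus_at h d e.
Proof.
move=> [d [_ hd]] e /exp2V_small[n ne].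
exists (2 ^- d [tuple n]); first by rewrite invr_gt0 exprn_gt0.
by move=> s t s01 t01 st; apply: le_trans ne; apply: hd.
Qed.

(** The sum of the two coordinate distances to [q] is continuous and positive along [g], hence
    bounded below by some [d]; one of the two terms is then at least [d / 2]. *)
Lemma away_from_range (g : R -> R * R) (q : R * R) :
  effectively_uniformly_continuous (fun t => (g t).1) ->
  effectively_uniformly_continuous (fun t => (g t).2) ->
  ~ path_range g q ->
  exists2 d : R, 0 < d & forall t : R, 0 <= t <= 1 -> d <= `|(g t).1 - q.1| \/ d <= `|(g t).2 - q.2|.
Proof.
move=> /GL_modulus m1 /GL_modulus m2 gq.
have [|e e_gt0|d d_gt0 hd] := @positive_lower_bound (fun t => `|(g t).1 - q.1| + `|(g t).2 - q.2|).
- move=> t t01; rewrite lt_def addr_ge0 // andbT paddr_eq0 // !normr_eq0 !subr_eq0.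
  apply/negP => /andP[/eqP g1 /eqP g2]; apply: gq; exists t; first by rewrite /= in_itv.
  by rewrite [LHS]surjective_pairing g1 g2 -surjective_pairing.
- have [d1 d1_gt0 h1] := m1 (e / 2) ltac:(lra).
  have [d2 d2_gt0 h2] := m2 (e / 2) ltac:(lra).
  exists (Num.min d1 d2); first by rewrite lt_min d1_gt0.
  move=> s t s01 t01; rewrite le_min => /andP[/(h1 _ _ s01 t01) st1 /(h2 _ _ s01 t01) st2].
  have T (x y z : R) : `| `|x - z| - `|y - z| | <= `|x - y|.
    by apply: le_trans (ler_dist_dist _ _) _; rewrite opprB addrA subrK.
  have := T (g s).1 (g t).1 q.1; have := T (g s).2 (g t).2 q.2 => T2 T1.
  rewrite opprD addrACA; apply: le_trans (ler_normD _ _) _; lra.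
exists (d / 2) => [|t t01]; first by lra.
have := hd t t01; have [|h1] := lerP (d / 2) `|(g t).1 - q.1|; first by left.
by right; lra.
Qed.

End Reals.

(** * Bisection *)

Definition nat_dist x y := (x - y + (y - x))%N.

Lemma nat_dist_norm (R : realType) x y : `|x%:R - y%:R| = (nat_dist x y)%:R :> R.
Proof.
rewrite /nat_dist; have [xy | yx] := leqP x y.
  by rewrite (eqP xy) distrC -natrB // ger0_norm.
by rewrite (eqP (ltnW yx)) addn0 -natrB 1?ltnW // ger0_norm.
Qed.

Section Crossing.
Variable R : realType.
Implicit Types f g : R -> R * R.

Lemma modulus_at_le (h : R -> R) d d' e :
  d' <= d -> modulus_at h d e -> modulus_at h d' e.
Proof. by move=> d'd hh s t s01 t01 st; apply: hh => //; apply: le_trans d'd. Qed.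

Lemma path_nat_approx f :
  computable_path f -> (forall t, 0 <= t <= 1 -> closed_unit_square (f t)) ->
  exists F1 F2, [/\ recursive2 F1, recursive2 F2,
    forall q m, `|(F1 q m)%:R - 2 ^+ m * (f (unit_seq R q)).1| <= 2 &
    forall q m, `|(F2 q m)%:R - 2 ^+ m * (f (unit_seq R q)).2| <= 2].
Proof.
move=> [[f1 _] [f2 _]] f_square.
have := f1 _ (@unit_seq_itv R) (@computable_unit_seq R).
move=> /computable_seq_nat_approx[|F1 rF1 F1f].
  by move=> q; have [/andP[]] := f_square _ (unit_seq_itv R q).
have := f2 _ (@unit_seq_itv R) (@computable_unit_seq R).
move=> /computable_seq_nat_approx[|F2 rF2 F2f].
  by move=> q; have [_ /andP[]] := f_square _ (unit_seq_itv R q).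
by exists F1, F2.
Qed.

(** The value [D q] is read off at the first precision where every vertex is visibly far from the
    point. Stating it for all multiples of [n] lets values found with different [n] be compared at a
    common multiple. *)
Lemma computable_side f g :
  computable_path f -> computable_path g ->
  (forall t, 0 <= t <= 1 -> closed_unit_square (f t)) ->
  (forall t, 0 <= t <= 1 -> closed_unit_square (g t)) ->
  g 0 = (0, 1) -> g 1 = (1, 0) ->
  (forall q, ~ path_range g (f (unit_seq R q))) ->
  exists2 D : nat -> bool, recursive1 D &
    forall q, exists2 n, (0 < n)%N &
      forall K, (0 < K)%N -> side g (f (unit_seq R q)) (n * K) = D q.
Proof.
move=> cf cg f_square g_square g0 g1 away.
have [F1 [F2 [rF1 rF2 F1f F2f]]] := path_nat_approx cf f_square.
have [G1 [G2 [rG1 rG2 G1g G2g]]] := path_nat_approx cg g_square.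
have [[_ c1] [_ c2]] := cg.
have [d1 [/recursive_curry1 rd1 d1g]] := c1; have [d2 [/recursive_curry1 rd2 d2g]] := c2.
(* The sum of the exponents dominates both, so a step [1 / N m] meets the modulus of either
   coordinate of [g]. *)
pose N m := (2 ^ (d1 [tuple m] + d2 [tuple m]))%N.
have N_gt0 m : (0 < N m)%N by rewrite expn_gt0.
have rN : recursive1 N.
  rewrite /recursive1 /N; apply: recursive_expn; apply: recursive_addn => //.
(* The index of [i / N m] in [unit_seq]. *)
pose t m i := (N m * N m + i)%N.
have G1t m i : (i <= N m)%N -> `|(G1 (t m i) m)%:R - 2 ^+ m * (g (i%:R / (N m)%:R)).1| <= 2.
  by move=> lei; rewrite -unit_seqE.
have G2t m i : (i <= N m)%N -> `|(G2 (t m i) m)%:R - 2 ^+ m * (g (i%:R / (N m)%:R)).2| <= 2.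
  by move=> lei; rewrite -unit_seqE.
have m1 m : modulus_at (fun t => (g t).1) (N m)%:R^-1 (2 ^- m).
  apply: modulus_at_le (d1g m).
  by rewrite natrX lef_pV2 ?posrE ?exprn_gt0 // ler_eXn2l ?ltr1n // leq_addr.
have m2 m : modulus_at (fun t => (g t).2) (N m)%:R^-1 (2 ^- m).
  apply: modulus_at_le (d2g m).
  by rewrite natrX lef_pV2 ?posrE ?exprn_gt0 // ler_eXn2l ?ltr1n // leq_addl.
(* Number of vertices not yet separated from the point at precision [m]; the search looks for 0. *)
pose bad m q := (\sum_(i < N m) ((nat_dist (G1 (t m i) m) (F1 q m) < 12) &&
                                 (nat_dist (G2 (t m i) m) (F2 q m) < 12)))%N.
have rbad : recursive2 bad.
  apply: (recursive_sum (F := fun i v => 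
    (nat_dist (G1 (t (nth 0%N v 0) i) (nth 0%N v 0)) (F1 (nth 0%N v 1) (nth 0%N v 0)) < 12) &&
    (nat_dist (G2 (t (nth 0%N v 0) i) (nth 0%N v 0)) (F2 (nth 0%N v 1) (nth 0%N v 0)) < 12))%N).
    recursive_tac. all: try done. 
  by rewrite /nat_dist /t; recursive_tac.
have [q | M rM Mbad] := recursive_min rbad.
  have [d d_gt0 hd] := away_from_range c1 c2 (away q).
  (* With this [m], a distance [d] becomes at least 16 after scaling, and two errors of 2 leave the
     required 12. *)
  have [m md] : exists m, 2 ^- m <= d / 16 by apply: exp2V_small; lra.
  exists m; rewrite /bad big1 // => i _; apply/eqP; rewrite eqb0.
  have P_gt0 : 0 < 2 ^+ m :> R by rewrite exprn_gt0.
  have Pd : 16 <= 2 ^+ m * d by rewrite -ler_pdivrMl //; lra.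
  have far (F G : nat) (x y : R) : d <= `|y - x| -> `|F%:R - 2 ^+ m * x| <= 2 ->
      `|G%:R - 2 ^+ m * y| <= 2 -> ~~ (nat_dist G F < 12)%N.
    move=> dyx; rewrite -leqNgt -(ler_nat R) -nat_dist_norm.
    have : 16 <= `|2 ^+ m * y - 2 ^+ m * x|.
      by rewrite -mulrBr normrM gtr0_norm //; apply: le_trans Pd _; rewrite ler_pM2l.
    have T (a b c e : R) : 16 <= `|a - b| -> `|c - b| <= 2 -> `|e - a| <= 2 -> 12 <= `|e - c|.
      rewrite !ler_norml => ab /andP[? ?] /andP[? ?]; rewrite ler_normr.
      by move: ab; rewrite ler_normr => /orP[?|?]; apply/orP; [left | right]; lra.
    exact: T.
  have lti : (i <= N m)%N by apply: ltnW.
  rewrite negb_and; apply/orP.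
  have [d1i | d2i] := hd _ (frac_itv R lti); [left | right].
    exact: far d1i (F1f _ _) (G1t _ _ _).
  exact: far d2i (F2f _ _) (G2t _ _ _).
exists (fun q => odd (crossings (fun i => F1 q (M q) + 5 < G1 (t (M q) i) (M q))%N
    (fun i => F2 q (M q) + 5 < G2 (t (M q) i) (M q))%N (N (M q)))).
  apply: recursive_odd; rewrite /crossings.
  apply: (recursive_sum (F := fun i v => let q := nth 0%N v 0 in
    ((F1 q (M q) + 5 < G1 (t (M q) i) (M q)) (+) (F1 q (M q) + 5 < G1 (t (M q) i.+1) (M q)))
    && (F2 q (M q) + 5 < G2 (t (M q) i) (M q)))%N); first by recursive_tac.
  by rewrite /t /=; recursive_tac.
move=> q; exists (N (M q)) => // K K_gt0.
have [/andP[p1 _] /andP[p2 _]] := f_square _ (unit_seq_itv R q).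
apply: (@side_approx _ _ g0 g1 _ (M q)) => //; [exact: G1t | exact: G2t |].
move=> i lti; have /eqP := Mbad q; rewrite sum_nat_eq0 => /forallP/(_ (Ordinal lti)).
rewrite eqb0 negb_and -!leqNgt !nat_dist_norm /= !(ler_nat R 12).
by case/orP; [left | right].
Qed.

(** Only the first edge counts: it starts at [(0, 1)], above the origin and not to its right, and
    all later vertices lie strictly to the right. *)
Lemma side_origin g n : (0 < n)%N -> g 0 = (0, 1) -> g 1 = (1, 0) ->
  (forall t : R, 0 < t < 1 -> open_unit_square (g t)) -> side g (0, 0) n.
Proof.
case: n => // n _ g0 g1 g_open; rewrite /side /crossings big_ord_recl big1 => [|i _].
  rewrite mul0r g0 /= !subr0 ltxx ltr01 andbT addn0.
  have [-> | n_gt0] := posnP n; first by rewrite divr1 g1 /= ltr01.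
  have [|/andP[-> _] _] // := g_open (1 / n.+1%:R).
  by rewrite divr_gt0 // ltr_pdivrMr // mul1r ltr1n ltnS.
have pos j : (0 < j <= n.+1)%N -> 0 < (g (j%:R / n.+1%:R)).1 - (0, 0 : R).1.
  rewrite subr0 => /andP[j_gt0]; rewrite leq_eqVlt => /orP[/eqP -> | ltjn].
    by rewrite divff ?pnatr_eq0 // g1 ltr01.
  have [|/andP[-> _] _] // := g_open (j%:R / n.+1%:R).
  by rewrite divr_gt0 ?ltr0n // ltr_pdivrMr // mul1r ltr_nat.
have ltin := ltn_ord i.
by rewrite /= /bump add1n (pos i.+1) ?(pos i.+2) //= ltnS // ltnW.
Qed.

Lemma side_corner g n :
  (forall t : R, 0 <= t <= 1 -> closed_unit_square (g t)) -> side g (1, 1) n = false.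
Proof.
move=> g_square; rewrite /side /crossings big1 // => i _.
have [_ /andP[_ g2]] := g_square _ (frac_itv R (ltnW (ltn_ord i))).
by rewrite [X in _ && X]ltNge /= subr_le0 g2 andbF.
Qed.

Lemma computable_point_seq f (x : nat -> R) q : computable_path f ->
  (forall n, 0 <= x n <= 1) -> computable_seq x -> computable_point (f (x q)).
Proof.
move=> [[f1 _] [f2 _]] x01 cx; split.
  exact: (computable_real_term q (f1 x x01 cx)).
exact: (computable_real_term q (f2 x x01 cx)).
Qed.

Lemma path_modulus f e : computable_path f -> 0 < e ->
  exists n, modulus_at (fun t => (f t).1) (2 ^- n) e /\ modulus_at (fun t => (f t).2) (2 ^- n) e.
Proof.
move=> [[_ /GL_modulus f1] [_ /GL_modulus f2]] e_gt0.
have [a a_gt0 fa] := f1 e e_gt0; have [b b_gt0 fb] := f2 e e_gt0.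
have [n] : exists n, 2 ^- n <= Num.min a b by apply: exp2V_small; rewrite lt_min a_gt0.
rewrite le_min => /andP[na nb].
by exists n; split; [exact: modulus_at_le fa | exact: modulus_at_le fb].
Qed.

(** The [k]-th interval starts at [X k / 2 ^ k], with [D] true at its left end and false at its
    right end. Indices 1 and 2 stand for the numbers 0 and 1. *)
Lemma recursive_bisection (D : nat -> bool) : recursive1 D ->
  (forall q q', unit_seq R q = unit_seq R q' -> D q = D q') -> D 1%N -> ~~ D 2%N ->
  exists X : nat -> nat, [/\ recursive1 X, X 0%N = 0%N,
    forall k, ((X k).*2 <= X k.+1 <= (X k).*2.+1)%N, forall k, (X k < 2 ^ k)%N &
    forall k, D (2 ^ k * 2 ^ k + X k)%N /\ ~~ D (2 ^ k * 2 ^ k + (X k).+1)%N].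
Proof.
move=> rD Dext D1 D2.
(* The index of the midpoint [(2 r + 1) / 2 ^ (i + 1)]; if [D] holds there, the right half is
   kept. *)
pose mid i r := (2 ^ i.+1 * 2 ^ i.+1 + (r * 2).+1)%N.
pose X k := iteri k (fun i r => r * 2 + D (mid i r))%N 0%N.
have XS k : X k.+1 = (X k * 2 + D (mid k (X k)))%N by [].
have step k : ((X k).*2 <= X k.+1 <= (X k).*2.+1)%N.
  by rewrite XS muln2; case: (D _); rewrite ?addn0 ?addn1 leqnn ?leqnSn.
have Xlt k : (X k < 2 ^ k)%N.
  elim: k => // k IHk; have /andP[_ h] := step k; rewrite expnS; lia.
exists X; split=> //.
  apply: (recursive_iteri (h := fun i r _ => r * 2 + D (mid i r))%N).
  - exact: recursive_nth.
  - exact: recursive_const.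
  - by rewrite /mid; recursive_tac.
(* An old endpoint has another index at the next level; [Dext] makes [D] agree on both. *)
have double k j : (j <= 2 ^ k)%N ->
    D (2 ^ k.+1 * 2 ^ k.+1 + j * 2)%N = D (2 ^ k * 2 ^ k + j)%N.
  move=> lej; apply: Dext; rewrite !unit_seqE ?expn_gt0 //; last by rewrite expnSr leq_mul2r.
  by rewrite expnSr !natrM -mulf_div divff ?mulr1 // pnatr_eq0.
elim=> [|k [IH1 IH2]]; first by [].
rewrite XS; have : D (mid k (X k)) = D (mid k (X k)) by [].
case: {2 3 4}(D _) => Dm; rewrite ?addn1 ?addn0; split.
- by rewrite Dm.
- by rewrite -[(_ * 2).+2]/((X k).+1 * 2)%N double.
- by rewrite double // ltnW.
- by rewrite Dm.
Qed.

End Crossing.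

Theorem theorem1p4 (R : realType) (f g : R -> R * R)
    (f_computable : computable_path f) (g_computable : computable_path g)
    (f_square : forall t : R, 0 <= t <= 1 -> closed_unit_square (f t))
    (g_square : forall t : R, 0 <= t <= 1 -> closed_unit_square (g t))
    (f0 : f 0 = (0, 0)) (f1 : f 1 = (1, 1))
    (g0 : g 0 = (0, 1)) (g1 : g 1 = (1, 0))
    (f_open : forall t : R, 0 < t < 1 -> open_unit_square (f t))
    (g_open : forall t : R, 0 < t < 1 -> open_unit_square (g t)) :
  exists x : R * R,
    computable_point x /\ (path_range f `&` path_range g)%classic x.
Proof.
have in_f t : 0 <= t <= 1 -> path_range f (f t) by exists t => //=; rewrite in_itv.
(* A classical alternative: no algorithm has to decide which case holds. *)
have [[q gq] | away] := pselect (exists q, path_range g (f (unit_seq R q))).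
  exists (f (unit_seq R q)); split; last by split=> //; apply: in_f; exact: unit_seq_itv.
  by apply: computable_point_seq => //; [exact: unit_seq_itv | exact: computable_unit_seq].
have {}away q : ~ path_range g (f (unit_seq R q)) by move=> gq; apply: away; exists q.
have [D rD sideD] := computable_side f_computable g_computable f_square g_square g0 g1 away.
(* Both values equal the side computed with the common multiple [n * n'] of the two edge numbers. *)
have Dext q q' : unit_seq R q = unit_seq R q' -> D q = D q'.
  move=> qq'; have [n n_gt0 Dn] := sideD q; have [n' n'_gt0 Dn'] := sideD q'.
  by rewrite -(Dn n') // -(Dn' n) // qq' mulnC.
have D1 : D 1%N.
  have u1 : unit_seq R 1 = 0 by rewrite -[1%N]/(1 * 1 + 0)%N unit_seqE // mul0r.
  have [n n_gt0 Dn] := sideD 1%N; rewrite -(Dn 1%N) // u1 f0.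
  by apply: side_origin; rewrite ?muln1.
have D2 : ~~ D 2%N.
  have u2 : unit_seq R 2 = 1 by rewrite -[2%N]/(1 * 1 + 1)%N unit_seqE // divr1.
  by have [n n_gt0 Dn] := sideD 2%N; rewrite -(Dn 1%N) // u2 f1 side_corner.
have [X [rX X0 Xstep Xlt XD]] := recursive_bisection rD Dext D1 D2.
have [s [s01 Xs]] := dyadic_nest R X0 Xstep.
have Xnear k : `|(X k)%:R / 2 ^+ k - s| <= 2 ^- k /\ `|(X k).+1%:R / 2 ^+ k - s| <= 2 ^- k.
  have := Xs k; rewrite -[(X k).+1%:R]natr1 mulrDl div1r !ler_norml => /andP[? ?].
  by have : 0 <= 2 ^- k :> R by [rewrite invr_ge0 exprn_ge0]; split; lra.
have cs : computable_real s by apply: computable_real_dyadic rX _ => k; case: (Xnear k).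
exists (f s); split.
  by apply: (computable_point_seq (x := fun=> s)) => //; [exact: 0%N | exact: computable_seq_const].
split; first exact: in_f.
apply: contrapT => fs_away.
have [[_ c1] [_ c2]] := g_computable.
have [d d_gt0 hd] := away_from_range c1 c2 fs_away.
have d4_gt0 : 0 < d / 4 by lra.
have [k [fk1 fk2]] := path_modulus f_computable d4_gt0.
have [l [gl1 gl2]] := path_modulus g_computable d4_gt0.
have [DX DX'] := XD k; have [near near'] := Xnear k.
have XE : unit_seq R (2 ^ k * 2 ^ k + X k) = (X k)%:R / 2 ^+ k.
  by rewrite unit_seqE ?expn_gt0 ?natrX // ltnW.
have XE' : unit_seq R (2 ^ k * 2 ^ k + (X k).+1) = (X k).+1%:R / 2 ^+ k.
  by rewrite unit_seqE ?expn_gt0 ?natrX.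
have x01 := unit_seq_itv R (2 ^ k * 2 ^ k + X k).
have x01' := unit_seq_itv R (2 ^ k * 2 ^ k + (X k).+1).
have [n n_gt0 Dn] := sideD (2 ^ k * 2 ^ k + X k)%N.
have [n' n'_gt0 Dn'] := sideD (2 ^ k * 2 ^ k + (X k).+1)%N.
(* Both ends of a short enough bisection interval have images within [d / 4] of [f s], so they
   should lie on the same side, against the bisection. *)
suff E : D (2 ^ k * 2 ^ k + X k)%N = D (2 ^ k * 2 ^ k + (X k).+1)%N by rewrite -E DX in DX'.
(* The number of edges [n * (n' * 2 ^ l)] is a multiple of both [n] and [n'], and large enough for
   the modulus of [g]. *)
rewrite -(Dn (n' * 2 ^ l)%N) ?muln_gt0 ?n'_gt0 ?expn_gt0 //.
rewrite -(Dn' (n * 2 ^ l)%N) ?muln_gt0 ?n_gt0 ?expn_gt0 // [(n' * (_ * _))%N]mulnCA.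
have [/andP[p1 _] /andP[p2 _]] := f_square _ x01.
have [/andP[p1' _] _] := f_square _ x01'.
have fine : (n * (n' * 2 ^ l))%:R^-1 <= 2 ^- l :> R.
  rewrite lef_pV2 ?posrE ?exprn_gt0 ?ltr0n ?muln_gt0 ?n_gt0 ?n'_gt0 ?expn_gt0 //.
  by rewrite -natrX ler_nat mulnA leq_pmull // muln_gt0 n_gt0.
apply: (side_near g0 g1 _ p1 p2 p1' hd) => //.
- by rewrite !muln_gt0 n_gt0 n'_gt0 expn_gt0.
- by apply: fk1 => //; rewrite XE.
- by apply: fk2 => //; rewrite XE.
- by apply: fk1 => //; rewrite XE'.
- by apply: fk2 => //; rewrite XE'.
- exact: modulus_at_le gl1.
- exact: modulus_at_le gl2.
Qed.
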